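(* There exists a universal constant $C>0$ such that the following holds. Let $d$ be an even positive integer, let $K,L,a,\delta$ be positive integers with $\delta\le \frac d4$, $d=aL$ and $1\le a<\delta$, let $\mathbf{m}_1,\dots,\mathbf{m}_K\in\mathbb{C}^d$ be vectors all of whose nonzero entries have indices in $\{1,\dots,\delta\}$, and let $0<p\le q$. Let $Z$ be the measurement map with coordinates $Z_{k,\ell}(\mathbf{x})=|\langle S_{\ell a}\mathbf{m}_k,\mathbf{x}\rangle|$, $1\le k\le K$, $1\le \ell\le L$, restricted to $\mathcal{C}_{p,q}\subset\mathbb{C}^d/\!\sim$. If $B$ is any map into $\mathbb{C}^d/\!\sim$, defined on a subset of $\mathbb{R}^{K\times L}$ containing $Z(\mathcal{C}_{p,q})$, which is Lipschitz with respect to the Euclidean norm on $\mathbb{R}^{K\times L}$ and the metric $D_2$ on $\mathbb{C}^d/\!\sim$, with Lipschitz constant $C_B$, and which satisfies $B(Z(\mathbf{x}))=\mathbf{x}$ for all $\mathbf{x}\in\mathcal{C}_{p,q}$, then $$C_B\;\ge\; C\,\frac{q\sqrt{da}}{p\sqrt{K}\,\|\mathbf{m}\|_\infty\,\delta^{3/2}}\;=\;C\,\frac{qd}{p\sqrt{KL}\,\|\mathbf{m}\|_\infty\,\delta^{3/2}},$$ where $\|\mathbf{m}\|_\infty:=\max_{1\le k\le K}\|\mathbf{m}_k\|_\infty$.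
   Context: Entries of $\mathbf{x}\in\mathbb{C}^d$ are written $\mathbf{x}(1),\dots,\mathbf{x}(d)$, and $\langle\mathbf{u},\mathbf{v}\rangle=\sum_{n=1}^d\mathbf{u}(n)\overline{\mathbf{v}(n)}$. The equivalence relation $\sim$ on $\mathbb{C}^d$ is: $\mathbf{x}\sim\mathbf{x}'$ iff $\mathbf{x}=e^{i\theta}\mathbf{x}'$ for some $\theta\in\mathbb{R}$. The metric $D_2$ on $\mathbb{C}^d/\!\sim$ is $D_2(\mathbf{x},\mathbf{x}')=\min_{\theta\in\mathbb{R}}\|\mathbf{x}-e^{i\theta}\mathbf{x}'\|_2$. For $\ell\in\mathbb{Z}$, the circular shift $S_\ell$ on $\mathbb{C}^d$ is $(S_\ell\mathbf{x})(n)=\mathbf{x}\big(((n+\ell-1)\bmod d)+1\big)$. The map $Z$ is well defined on $\mathbb{C}^d/\!\sim$. For $0<p\le q$, $\mathcal{C}_{p,q}=\{\mathbf{x}\in\mathbb{C}^d/\!\sim\;:\; p\le|\mathbf{x}(n)|\le q \text{ for all }1\le n\le d\}$. The Lipschitz constant of a map is its smallest valid Lipschitz constant. ''Universal'' means independent of all of $d,K,L,a,\delta,p,q$, the masks $\mathbf{m}_k$, and $B$. *)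

(* Defs.v *)
From HB Require Import structures.
From mathcomp Require Import all_boot all_order all_algebra generic_quotient.
From mathcomp Require Import complex.
From mathcomp Require Import all_classical all_reals all_analysis.
From mathcomp Require Import ring lra.

Set Implicit Arguments.
Unset Strict Implicit.
Unset Printing Implicit Defensive.

Import Order.TTheory GRing.Theory Num.Theory.
Import ComplexField Normc.

Local Open Scope quotient_scope.
Local Open Scope classical_set_scope.
Local Open Scope complex_scope.
Local Open Scope ring_scope.

(* C^d is 'rV[R[i]]_d; entries are indexed from 0, so the entry x(n) of the
   usual 1-based notation is x 0 i with i = n - 1. *)

Section Vectors.
Variables (R : realType) (d : nat).
Implicit Types (u v x y : 'rV[R[i]]_d).

Definition inner u v : R[i] := \sum_(n < d) u 0 n * (v 0 n)^*.

Definition l2norm x : R := Num.sqrt (\sum_(n < d) normc (x 0 n) ^+ 2).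

Definition linfnorm x : R := \big[Num.max/0]_(n < d) normc (x 0 n).

Lemma shift_subproof (l : int) (i : 'I_d) :
  (absz ((i%:Z + l) %% d%:Z)%Z < d)%N.
Proof.
have d0 : (0 < d%:Z)%R by rewrite ltz_nat (leq_ltn_trans _ (ltn_ord i)).
rewrite -ltz_nat gez0_abs ?ltz_pmod// modz_ge0//.
by rewrite gt_eqF.
Qed.

Definition shift (l : int) x : 'rV[R[i]]_d :=
  \row_(i < d) x 0 (Ordinal (shift_subproof l i)).

End Vectors.

Section Phase.
Variable R : realType.

Definition expi (t : R) : R[i] := cos t +i* sin t.

Lemma expi0 : expi 0 = 1.
Proof. by rewrite /expi cos0 sin0. Qed.

Lemma expiD (s t : R) : expi (s + t) = expi s * expi t.
Proof.
rewrite /expi cosD sinD; apply/eqP; rewrite eq_complex /=.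
by rewrite eqxx /=; apply/eqP; ring.
Qed.

Lemma normc_expi (t : R) : normc (expi t) = 1.
Proof. by rewrite /normc /= cos2Dsin2 sqrtr1. Qed.

(* Every point of the unit circle is some e^{i theta}. *)
Lemma expi_surj (c s : R) : c ^+ 2 + s ^+ 2 = 1 ->
  exists t, cos t = c /\ sin t = s.
Proof.
move=> cs.
have c1 : -1 <= c <= 1 by apply/andP; split; nra.
have st : sin (acos c) = `|s|.
  rewrite sin_acos// (_ : 1 - c ^+ 2 = s ^+ 2) ?sqrtr_sqr//; lra.
have [s0|s0] := leP 0 s.
- by exists (acos c); rewrite acosK// st ger0_norm.
- by exists (- acos c); rewrite cosN sinN acosK// st ltr0_norm// opprK.
Qed.

End Phase.

Section Quotient.
Variables (R : realType) (d : nat).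
Implicit Types (x y : 'rV[R[i]]_d).

Definition phase_rel : rel 'rV[R[i]]_d :=
  fun x y => `[< exists t : R, x = expi t *: y >].

Lemma phase_rel_refl : reflexive phase_rel.
Proof. by move=> x; apply/asboolP; exists 0; rewrite expi0 scale1r. Qed.

Lemma phase_rel_sym : symmetric phase_rel.
Proof.
suff h x y : phase_rel x y -> phase_rel y x by move=> x y; apply/idP/idP => /h.
move=> /asboolP[t ->]; apply/asboolP; exists (- t).
by rewrite scalerA -expiD addNr expi0 scale1r.
Qed.

Lemma phase_rel_trans : transitive phase_rel.
Proof.
move=> y x z /asboolP[s ->] /asboolP[t ->]; apply/asboolP; exists (s + t).
by rewrite scalerA expiD.
Qed.

Canonical phase_equiv :=
  EquivRel phase_rel phase_rel_refl phase_rel_sym phase_rel_trans.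

Definition CdPhase := {eq_quot phase_equiv}.

Implicit Types (X Y : CdPhase).

Lemma repr_piP x : exists t : R, repr (\pi_(CdPhase) x) = expi t *: x.
Proof.
have /eqquotP/asboolP[t ht] : repr (\pi_(CdPhase) x) = x %[mod CdPhase].
  by rewrite reprK.
by exists t.
Qed.

(* [D2_pi] and [D2_min] below show that the choice of representatives is
   immaterial and that the infimum is a minimum. *)
Definition D2 X Y : R :=
  inf [set l2norm (repr X - expi t *: repr Y) | t in [set: R]].

Definition Cpq (p q : R) : set CdPhase :=
  [set X | forall n : 'I_d, p <= normc ((repr X : 'rV[R[i]]_d) 0 n) <= q].

Lemma l2normZ (c : R[i]) x : normc c = 1 -> l2norm (c *: x) = l2norm x.
Proof.
move=> c1; congr Num.sqrt; apply: eq_bigr => n _.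
by rewrite mxE normcM c1 mul1r.
Qed.

Lemma D2_pi x y : D2 (\pi_(CdPhase) x) (\pi_(CdPhase) y) =
  inf [set l2norm (x - expi t *: y) | t in [set: R]].
Proof.
rewrite /D2; have [s ->] := repr_piP x; have [r ->] := repr_piP y.
congr inf; apply/seteqP; split => _ [t _ <-].
- exists (t + r - s) => //.
  rewrite -(l2normZ _ (normc_expi s)) scalerBr !scalerA -!expiD.
  by rewrite (addrC s) subrK.
- exists (t - r + s) => //.
  rewrite -[in RHS](l2normZ _ (normc_expi s)) scalerBr !scalerA -!expiD.
  by rewrite addrAC subrK (addrC s).
Qed.

Lemma l2norm_sub_sqr x y : exists a b c : R, forall t,
  l2norm (x - expi t *: y) = Num.sqrt (c - (a * cos t + b * sin t)).
Proof.
exists (\sum_(n < d) 2 * (complex.Re (x 0 n) * complex.Re (y 0 n) +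
                           complex.Im (x 0 n) * complex.Im (y 0 n))).
exists (\sum_(n < d) 2 * (complex.Im (x 0 n) * complex.Re (y 0 n) -
                           complex.Re (x 0 n) * complex.Im (y 0 n))).
exists (\sum_(n < d) (normc (x 0 n) ^+ 2 + normc (y 0 n) ^+ 2)) => t.
congr Num.sqrt; rewrite !mulr_suml -big_split/= -sumrB.
apply: eq_bigr => n _; rewrite !mxE.
case: (x 0 n) => xr xi; case: (y 0 n) => yr yi.
rewrite /normc /= !sqr_sqrtr ?addr_ge0 ?sqr_ge0//.
have := cos2Dsin2 t; move: (cos t) (sin t) => c s cs.
have -> : yr ^+ 2 + yi ^+ 2 = (c ^+ 2 + s ^+ 2) * (yr ^+ 2 + yi ^+ 2).
  by rewrite cs mul1r.
ring.
Qed.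

Lemma l2norm_sub_min x y : exists t0 : R, forall t : R,
  l2norm (x - expi t0 *: y) <= l2norm (x - expi t *: y).
Proof.
have [a [b [c h]]] := l2norm_sub_sqr x y.
have [r0|r0] := eqVneq (a ^+ 2 + b ^+ 2) 0.
  have [a0 b0] : a = 0 /\ b = 0.
    move/eqP: r0; rewrite paddr_eq0 ?sqr_ge0// !sqrf_eq0.
    by case/andP => /eqP-> /eqP->.
  by exists 0 => t; rewrite 2!h a0 b0 !mul0r.
have rp : 0 < a ^+ 2 + b ^+ 2 by rewrite lt0r r0 addr_ge0 ?sqr_ge0.
pose r := Num.sqrt (a ^+ 2 + b ^+ 2).
have r2 : r ^+ 2 = a ^+ 2 + b ^+ 2 by rewrite sqr_sqrtr// ltW.
have rgt : 0 < r by rewrite sqrtr_gt0.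
have [|t0 [ct st]] := @expi_surj R (a / r) (b / r).
  by rewrite !expr_div_n -mulrDl r2 divff.
exists t0 => t; rewrite 2!h ler_wsqrtr// lerB// ct st.
have -> : a * (a / r) + b * (b / r) = r.
  by rewrite !mulrA -mulrDl -!expr2 -r2 expr2 mulfK// gt_eqF.
have cs := cos2Dsin2 t; move: (cos t) (sin t) cs => u v uv.
apply: le_trans (ler_norm _) _; rewrite -ler_sqr ?nnegrE ?normr_ge0 ?(ltW rgt)//.
rewrite real_normK ?num_real// r2.
have -> : a ^+ 2 + b ^+ 2 = (a ^+ 2 + b ^+ 2) * (u ^+ 2 + v ^+ 2).
  by rewrite uv mulr1.
rewrite -subr_ge0.
have -> : (a ^+ 2 + b ^+ 2) * (u ^+ 2 + v ^+ 2) - (a * u + b * v) ^+ 2 =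
  (a * v - b * u) ^+ 2 by ring.
exact: sqr_ge0.
Qed.

Lemma D2_min x y : exists t0 : R,
  D2 (\pi_(CdPhase) x) (\pi_(CdPhase) y) = l2norm (x - expi t0 *: y) /\
  forall t : R, l2norm (x - expi t0 *: y) <= l2norm (x - expi t *: y).
Proof.
have [t0 h] := l2norm_sub_min x y; exists t0; split => //; rewrite D2_pi.
apply/eqP; rewrite eq_le; apply/andP; split.
- apply: ge_inf; last by exists t0.
  by exists 0 => _ [t _ <-]; apply: sqrtr_ge0.
- by apply: lb_le_inf; [exists (l2norm (x - expi t0 *: y)), t0|move=> _ [t _ <-]].
Qed.

Lemma Cpq_pi (p q : R) x :
  Cpq p q (\pi_(CdPhase) x) <-> forall n : 'I_d, p <= normc (x 0 n) <= q.
Proof.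
rewrite /Cpq /=; have [t ->] := repr_piP x.
by split => h n; have := h n; rewrite mxE normcM normc_expi mul1r.
Qed.

End Quotient.

Section Measurements.
Variables (R : realType) (d K L : nat).

(* The column index l : 'I_L stands for the 1-based index l + 1. *)
Definition Zmap (a : nat) (m : 'I_K -> 'rV[R[i]]_d) (X : CdPhase R d) :
    'M[R]_(K, L) :=
  \matrix_(k < K, l < L) normc (inner (shift (l.+1 * a)%N%:Z (m k)) (repr X)).

Lemma Zmap_pi a m (x : 'rV[R[i]]_d) :
  Zmap a m (\pi_(CdPhase R d) x) =
  \matrix_(k < K, l < L) normc (inner (shift (l.+1 * a)%N%:Z (m k)) x).
Proof.
apply/matrixP => k l; rewrite !mxE; have [t ->] := repr_piP x.
rewrite (_ : inner _ (expi t *: x) =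
             (expi t)^* * inner (shift (l.+1 * a)%N%:Z (m k)) x).
  rewrite normcM (_ : normc _ = 1) ?mul1r//.
  by rewrite /expi /normc/= sqrrN cos2Dsin2 sqrtr1.
rewrite /inner mulr_sumr; apply: eq_bigr => n _.
by rewrite [(_ *: x) _ _]mxE rmorphM mulrCA.
Qed.

Definition maskmax (m : 'I_K -> 'rV[R[i]]_d) : R :=
  \big[Num.max/0]_(k < K) linfnorm (m k).

Definition l2norm_mx (A : 'M[R]_(K, L)) : R :=
  Num.sqrt (\sum_(k < K) \sum_(l < L) A k l ^+ 2).

(* A map defined on E is a total function whose values outside E are ignored. *)
Definition lipschitz_bound (E : set 'M[R]_(K, L))
    (B : 'M[R]_(K, L) -> CdPhase R d) (c : R) : Prop :=
  0 <= c /\ forall u v, E u -> E v -> D2 (B u) (B v) <= c * l2norm_mx (u - v).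

Definition lipschitz_const (E : set 'M[R]_(K, L))
    (B : 'M[R]_(K, L) -> CdPhase R d) (c : R) : Prop :=
  lipschitz_bound E B c /\ forall c', lipschitz_bound E B c' -> c <= c'.

Lemma lipschitz_const_exists E B c :
  lipschitz_bound E B c -> exists c0, lipschitz_const E B c0.
Proof.
move=> hc; set S := [set c | lipschitz_bound E B c].
have lb0 : lbound S 0 by move=> x [].
have hS : has_inf S by split; [exists c|exists 0].
exists (inf S); split; last by move=> c' h; apply: ge_inf => //; exists 0.
split; first by apply: lb_le_inf; [exists c|].
move=> u v Eu Ev; have [n0|n0] := eqVneq (l2norm_mx (u - v)) 0.
  by have := hc.2 u v Eu Ev; rewrite n0 !mulr0.
have np : 0 < l2norm_mx (u - v) by rewrite lt0r n0 sqrtr_ge0.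
rewrite -ler_pdivrMr//; apply: lb_le_inf; first by exists c.
by move=> c' [_ h]; rewrite ler_pdivrMr// h.
Qed.

End Measurements.

(* Main.v *)
Require Import Defs.
From mathcomp Require Import all_boot all_order all_algebra.
From mathcomp Require Import complex.
From mathcomp Require Import all_classical all_reals all_analysis.
From mathcomp Require Import zify ring lra.

Import Order.TTheory GRing.Theory Num.Theory.
Local Open Scope classical_set_scope.
Local Open Scope ring_scope.

(** The recovery map must separate two vectors that are far apart but have
nearly equal measurements.  Write [d = h + h].  The vector [test_pos] has
modulus [q] everywhere except on two bridges of [delta] entries of modulus
[p], one at the end of each half; [test_neg] is the same vector with its
second half negated.

- They are far apart: the relative phase of the halves has changed by [-1],
  and a global phase cannot repair both halves at once.  For every [t] the two
  halves together contribute [|1 - e^(it)|^2 + |1 + e^(it)|^2 = 4] times the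
  energy of one half, and the bridges occupy at most half of each half, so
  that the distance is at least [q * sqrt d] ([D2_test]).

- Their measurements are close: a shifted mask that sees one half only cannot
  detect the sign.  A mask that sees both halves straddles one of the two
  junctions, and since its support is an arc of [delta] entries, the part that
  lies before the junction lies in a bridge.  As
  [| |x + y| - |x - y| | <= 2 * min(|x|, |y|)], the measurement changes by at
  most [2 * delta * |m| * p] ([shifted_mask_diff]).  Only about [delta / a]
  shifts straddle each junction ([card_straddles]), and summing the squares
  over the masks and these shifts gives [measurement_distance].

The ratio of the two estimates bounds every Lipschitz constant of the
recovery map from below, with [C = 1/4]. *)

(** * Shifts that straddle a junction *)

Lemma card_ord_interval (n lo k : nat) (A : {pred 'I_n}) :
  (forall i, i \in A -> lo <= i < lo + k)%N -> (#|A| <= k)%N.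
Proof.
case: k => [|k] Alo.
  rewrite leqn0; apply/eqP/eq_card0 => i; apply/negbTE/negP => /Alo; lia.
rewrite -[X in (_ <= X)%N]card_ord.
apply: (@leq_card_in _ _ (fun i : 'I_n => inord (i - lo) : 'I_k.+1)).
move=> i j /Alo iA /Alo jA /(congr1 (@nat_of_ord _)).
rewrite !inordK; [|lia|lia] => ij; apply: val_inj => /=; lia.
Qed.

(** The arc of [delta] indices that starts at [- t] modulo [h + h] meets both
halves.  The first range of [t] is for an arc across the junction at [0], the
second for one across the junction at [h]. *)
Definition straddles (h delta t : nat) : bool :=
  (0 < t < delta)%N || (h < t < h + delta)%N.

(** There are at most [delta / a + 1] multiples of [a] in the interval; the
hypothesis [a <= delta] absorbs the extra one into the factor [2]. *)
Lemma card_multiples_in_interval (L a delta e : nat) : (0 < a)%N -> (a <= delta)%N ->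
  (#|[pred l : 'I_L | e < l.+1 * a < e + delta]| * a <= 2 * delta)%N.
Proof.
move=> a0 ad; apply: (@leq_trans ((delta %/ a).+1 * a)).
  rewrite leq_mul2r; apply/orP; right.
  apply: (@card_ord_interval _ (e %/ a)) => l; rewrite inE => /andP[el le].
  have := divn_eq e a; have := ltn_pmod e a0.
  have := divn_eq delta a; have := ltn_pmod delta a0.
  move: (e %/ a)%N (e %% a)%N (delta %/ a)%N (delta %% a)%N.
  move=> e1 e2 d1 d2 d2a dE e2a eE; subst e delta.
  apply/andP; split; nia.
by rewrite mulSn mul2n -addnn leq_add// leq_divM.
Qed.

Lemma card_straddles (L a delta h : nat) : (0 < a)%N -> (a <= delta)%N ->
  (#|[pred l : 'I_L | straddles h delta (l.+1 * a)]| * a <= 4 * delta)%N.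
Proof.
move=> a0 ad.
have := @card_multiples_in_interval L a delta 0 a0 ad.
have := @card_multiples_in_interval L a delta h a0 ad.
set A := #|_|; set B := #|_| => Ah B0.
have : (#|[pred l : 'I_L | straddles h delta (l.+1 * a)]| <= B + A)%N.
  rewrite -[in X in (_ <= X)%N]cardUI; apply: leq_trans (leq_addr _ _).
  by apply: subset_leq_card; apply/fintype.subsetP => l; rewrite !inE.
nia.
Qed.

(** * Moduli of complex numbers *)

Section Modulus.
Variable R : realType.

Lemma normc_real (x : R) : Normc.normc x%:C%C = `|x|.
Proof. by rewrite /Normc.normc /= expr0n /= addr0 sqrtr_sqr. Qed.

Lemma conj_real (x : R) : (x%:C%C)^* = x%:C%C.
Proof. exact: conjc_real. Qed.

Lemma normc_add (x y : R[i]) :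
  Normc.normc (x + y) <= Normc.normc x + Normc.normc y.
Proof. exact: le_normcD. Qed.

Lemma normc_opp (x : R[i]) : Normc.normc (- x) = Normc.normc x.
Proof. exact: normcN. Qed.

(** Negating one of two summands changes the modulus of the sum by at most twice
the modulus of that summand, however large the other one is. *)
Lemma normc_flip (x y : R[i]) :
  `|Normc.normc (x + y) - Normc.normc (x - y)| <= 2 * Normc.normc y.
Proof.
have Exy : x - y + (y + y) = x + y by ring.
have Exy' : x + y + (- y - y) = x - y by ring.
have := normc_add (x - y) (y + y); have := normc_add (x + y) (- y - y).
have := normc_add y y; have := normc_add (- y) (- y).
by rewrite Exy Exy' normc_opp ler_norml => H1 H2 H3 H4; apply/andP; split; lra.
Qed.

Lemma normc_sum (I : finType) (P : pred I) (F : I -> R[i]) :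
  Normc.normc (\sum_(i | P i) F i) <= \sum_(i | P i) Normc.normc (F i).
Proof.
elim/big_ind2: _ => //; first by rewrite Normc.normc0.
by move=> x1 x2 y1 y2 h1 h2; apply: le_trans (normc_add _ _) _; apply: lerD.
Qed.

Lemma normc_subs_expi (t c : R) :
  Normc.normc (c%:C%C - expi t * c%:C%C) ^+ 2 = c ^+ 2 * (2 - 2 * cos t).
Proof.
rewrite /expi /Normc.normc /= sqr_sqrtr ?addr_ge0 ?sqr_ge0//.
have := cos2Dsin2 t; move: (cos t) (sin t) => u v uv.
by transitivity (c ^+ 2 * (1 - 2 * u + (u ^+ 2 + v ^+ 2))); [ring|rewrite uv; ring].
Qed.

Lemma normc_adds_expi (t c : R) :
  Normc.normc (c%:C%C - expi t * (- c)%:C%C) ^+ 2 = c ^+ 2 * (2 + 2 * cos t).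
Proof.
rewrite /expi /Normc.normc /= sqr_sqrtr ?addr_ge0 ?sqr_ge0//.
have := cos2Dsin2 t; move: (cos t) (sin t) => u v uv.
by transitivity (c ^+ 2 * (1 + 2 * u + (u ^+ 2 + v ^+ 2))); [ring|rewrite uv; ring].
Qed.

End Modulus.

(** * The two test vectors *)

Section TestVectors.
Variables (R : realType) (h delta : nat) (p q : R).

Definition profile (n : nat) : R :=
  if (h - delta <= n %% h)%N then p else q.

Definition test_pos : 'rV[R[i]]_(h + h) := \row_n (profile n)%:C%C.

Definition test_neg : 'rV[R[i]]_(h + h) :=
  \row_n (if (n < h)%N then profile n else - profile n)%:C%C.

Lemma test_pos_Cpq : 0 < p -> p <= q ->
  Cpq p q (\pi_(CdPhase R (h + h))%qT test_pos).
Proof.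
move=> p0 pq; apply/Cpq_pi => n; rewrite mxE normc_real /profile.
by case: ifP => _; rewrite ger0_norm; lra.
Qed.

Lemma test_neg_Cpq : 0 < p -> p <= q ->
  Cpq p q (\pi_(CdPhase R (h + h))%qT test_neg).
Proof.
move=> p0 pq; apply/Cpq_pi => n; rewrite mxE normc_real.
by case: ifP => _; rewrite /profile; case: ifP => _;
  rewrite ?normrN ger0_norm; lra.
Qed.

(** The dependence on [t] cancels between the entries [i] and [h + i], which
contribute [2 - 2 cos t] and [2 + 2 cos t] times the same square. *)
Lemma l2norm_test_sub (t : R) :
  l2norm (test_pos - expi t *: test_neg) =
  Num.sqrt (4 * \sum_(i < h) profile i ^+ 2).
Proof.
congr Num.sqrt; rewrite big_split_ord /= mulr_sumr -big_split /=.
apply: eq_bigr => i _; rewrite !mxE /= ltn_ord ltnNge leq_addr /=.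
have -> : profile (h + i)%N = profile i by rewrite /profile modnDl.
by rewrite normc_subs_expi normc_adds_expi; ring.
Qed.

(** The [h - delta >= (h + h) / 4] entries of modulus [q] in one half already
give this bound. *)
Lemma D2_test : (2 * delta <= h)%N -> 0 <= q ->
  q * Num.sqrt (h + h)%:R <=
  D2 (\pi_(CdPhase R (h + h))%qT test_pos) (\pi_(CdPhase R (h + h))%qT test_neg).
Proof.
move=> dh q0; have [t [-> _]] := D2_min test_pos test_neg.
rewrite l2norm_test_sub -{1}(ger0_norm q0) -sqrtr_sqr -sqrtrM ?sqr_ge0//.
rewrite ler_wsqrtr//.
have le_sum : q ^+ 2 * (h - delta)%:R <= \sum_(i < h) profile i ^+ 2.
  rewrite -(big_mkord xpredT (fun i => profile i ^+ 2)).
  rewrite (big_cat_nat (n := (h - delta)%N)) ?leq_subr//=.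
  rewrite [X in _ <= X + _](_ : _ = q ^+ 2 * (h - delta)%:R).
    by rewrite lerDl sumr_ge0// => i _; rewrite sqr_ge0.
  rewrite (@eq_big_nat _ _ _ _ _ _ (fun=> q ^+ 2)).
    by rewrite sumr_const_nat subn0 mulr_natr.
  move=> i /andP[_ ih]; rewrite /profile modn_small; last lia.
  by rewrite leqNgt ih.
have : (h + h <= 4 * (h - delta))%N by lia.
rewrite -(ler_nat R) natrM => dh'.
have := sqr_ge0 q; nra.
Qed.

Section Window.
Variables (w : 'rV[R[i]]_(h + h)) (M : R).

Definition half_sum (b : bool) : R[i] :=
  \sum_(n < h + h | (n < h)%N == b) w 0 n * (profile n)%:C%C.

Lemma inner_test_pos : inner w test_pos = half_sum true + half_sum false.
Proof.
rewrite /inner (bigID (fun n : 'I_(h + h) => (n < h)%N)) /=.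
congr (_ + _); apply: eq_big => n; rewrite ?eqbF_neg ?eqb_id// => _.
  by rewrite mxE conj_real.
by rewrite mxE conj_real.
Qed.

Lemma inner_test_neg : inner w test_neg = half_sum true - half_sum false.
Proof.
rewrite /inner (bigID (fun n : 'I_(h + h) => (n < h)%N)) /= -sumrN.
congr (_ + _); apply: eq_big => n; rewrite ?eqbF_neg ?eqb_id// => nh.
  by rewrite mxE nh conj_real.
by rewrite mxE (negbTE nh) conj_real rmorphN mulrN.
Qed.

(** Both choices of [b] are allowed because a global sign does not change the
modulus: negating the second half amounts to negating the first. *)
Lemma measurement_diff (b : bool) :
  `|Normc.normc (inner w test_pos) - Normc.normc (inner w test_neg)| <=
  2 * Normc.normc (half_sum b).
Proof.
rewrite inner_test_pos inner_test_neg; case: b; last exact: normc_flip.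
rewrite -[half_sum true - _]opprB normc_opp (addrC (half_sum true)); exact: normc_flip.
Qed.

(** If all that [w] sees of one half is its bridge, it sees at most [delta]
entries there, each of modulus [p] instead of [q]. *)
Lemma half_sum_bridge (b : bool) : (delta <= h)%N -> 0 <= p -> 0 <= M ->
  (forall n, Normc.normc (w 0 n) <= M) ->
  (forall n : 'I_(h + h), (n < h)%N = b -> w 0 n != 0 ->
     (h - delta <= n %% h)%N) ->
  Normc.normc (half_sum b) <= delta%:R * (M * p).
Proof.
move=> dh p0 M0 wM wb; apply: le_trans (normc_sum _ _ _ _) _.
pose A := [pred n : 'I_(h + h) | ((n < h)%N == b) && (h - delta <= n %% h)%N].
have cA : (#|A| <= delta)%N.
  apply: (@card_ord_interval _ (if b then h - delta else h + h - delta)%N) => n.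
  rewrite inE => /andP[/eqP nb nd]; case: b nb {wb A} => nb.
    by rewrite modn_small// in nd; lia.
  have nh : (n - h < h)%N by have := ltn_ord n; lia.
  have E : (n %% h = n - h)%N.
    by rewrite -{1}(@subnK h n) ?modnDr ?modn_small//; lia.
  rewrite E in nd; lia.
apply: (@le_trans _ _ (\sum_(n in A) M * p)); last first.
  rewrite sumr_const -[X in X <= _]mulr_natl ler_wpM2r ?ler_nat//.
  by rewrite mulr_ge0.
rewrite [X in _ <= X](eq_bigl (fun n : 'I_(h + h) =>
  ((n < h)%N == b) && (h - delta <= n %% h)%N)); last by [].
rewrite [X in _ <= X]big_mkcondr /=; apply: ler_sum => n /eqP nb.
rewrite Normc.normcM normc_real.
case: ifP => nd.
  by rewrite /profile nd ger0_norm// ler_wpM2r.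
have [->|/(wb n nb)] := eqVneq (w 0 n) 0; last by rewrite nd.
by rewrite Normc.normc0 mul0r.
Qed.

End Window.
End TestVectors.

(** * Distance between the measurements *)

Section Masks.
Variable R : realType.

Lemma shift_support (d delta t : nat) (x : 'rV[R[i]]_d) :
  (forall n : 'I_d, x 0 n != 0 -> (n < delta)%N) ->
  forall n : 'I_d, Defs.shift t%:Z x 0 n != 0 -> ((n + t) %% d < delta)%N.
Proof. by move=> xd n; rewrite mxE => /xd /=; rewrite -PoszD modz_nat absz_nat. Qed.

Lemma normc_shift_le (d : nat) (t : int) (x : 'rV[R[i]]_d) (n : 'I_d) :
  Normc.normc (Defs.shift t x 0 n) <= linfnorm x.
Proof.
rewrite mxE.
exact: (le_bigmax 0 (fun n => Normc.normc (x 0 n)) (Ordinal (shift_subproof t n))).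
Qed.

Lemma linfnorm_ge0 (d : nat) (x : 'rV[R[i]]_d) : 0 <= linfnorm x.
Proof. exact: bigmax_ge_id. Qed.

(** A straddling arc ends in the half that follows the junction, so its part in
the other half lies within the last [delta] entries of that half.  Here
[2 * delta <= h] keeps an arc from reaching a second junction. *)
Lemma shifted_mask_diff (h delta t : nat) (p q : R) (x : 'rV[R[i]]_(h + h)) :
  (2 * delta <= h)%N -> 0 <= p -> (0 < t <= h + h)%N ->
  (forall n : 'I_(h + h), x 0 n != 0 -> (n < delta)%N) ->
  `|Normc.normc (inner (Defs.shift t%:Z x) (test_pos R h delta p q)) -
    Normc.normc (inner (Defs.shift t%:Z x) (test_neg R h delta p q))| <=
  if straddles h delta t then 2 * (delta%:R * (linfnorm x * p)) else 0.
Proof.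
move=> dh p0 /andP[t0 th] /(shift_support _ _ t) xt.
have arc (n : 'I_(h + h)) : Defs.shift t%:Z x 0 n != 0 ->
    (h + h <= n + t < h + h + delta)%N || (n + t < delta)%N.
  move/xt; have := ltn_ord n; have [nt|nt] := ltnP (n + t) (h + h).
    by rewrite modn_small// => _ ->; rewrite orbT.
  move=> nh; rewrite -{1}(@subnK (h + h) (n + t))// modnDr modn_small; lia.
(* [b] selects the half that precedes the junction. *)
have bridge b : (forall n : 'I_(h + h), (n < h)%N = b ->
    Defs.shift t%:Z x 0 n != 0 -> (h - delta <= n %% h)%N) ->
    `|Normc.normc (inner (Defs.shift t%:Z x) (test_pos R h delta p q)) -
      Normc.normc (inner (Defs.shift t%:Z x) (test_neg R h delta p q))| <=
    2 * (delta%:R * (linfnorm x * p)).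
  move=> H; apply: le_trans (measurement_diff _ _ _ _ _ _ b) _.
  rewrite ler_wpM2l//; apply: half_sum_bridge => //; first lia.
  - exact: linfnorm_ge0.
  - by move=> n; apply: normc_shift_le.
have vanish b : (forall n : 'I_(h + h), (n < h)%N = b ->
    Defs.shift t%:Z x 0 n = 0) ->
    `|Normc.normc (inner (Defs.shift t%:Z x) (test_pos R h delta p q)) -
      Normc.normc (inner (Defs.shift t%:Z x) (test_neg R h delta p q))| <= 0.
  move=> H; apply: le_trans (measurement_diff _ _ _ _ _ _ b) _.
  rewrite /half_sum big1 ?Normc.normc0 ?mulr0// => n /eqP/H ->.
  by rewrite mul0r.
have modE (n : 'I_(h + h)) : (n %% h = if n < h then n : nat else n - h)%N.
  have := ltn_ord n; case: (ltnP n h) => nh nhh; first by rewrite modn_small.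
  by rewrite -{1}(@subnK h n)// modnDr modn_small//; lia.
rewrite /straddles; case: ifP => [/orP[]/andP[t1 t2]|].
- apply: (bridge false) => n nh /arc; rewrite modE nh.
  by have := ltn_ord n; lia.
- apply: (bridge true) => n nh /arc; rewrite modE nh.
  by have := ltn_ord n; lia.
- move/negbT; rewrite negb_or => /andP[s1 s2].
  have [th'|th'] := leqP t h.
    apply: (vanish true) => n nh; apply/eqP/negPn/negP => /arc; lia.
  apply: (vanish false) => n nh; apply/eqP/negPn/negP => /arc.
  have := ltn_ord n; lia.
Qed.

(** The factor [sqrt a] on the left avoids dividing by [a] in the count of the
straddling shifts. *)
Lemma measurement_distance (K L h a delta : nat) (p q : R)
    (m : 'I_K -> 'rV[R[i]]_(h + h)) :
  (2 * delta <= h)%N -> 0 <= p -> (h + h = a * L)%N -> (0 < a <= delta)%N ->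
  (forall (k : 'I_K) (n : 'I_(h + h)), m k 0 n != 0 -> (n < delta)%N) ->
  Num.sqrt a%:R * l2norm_mx
    (Zmap L a m (\pi_(CdPhase R (h + h))%qT (test_pos R h delta p q)) -
     Zmap L a m (\pi_(CdPhase R (h + h))%qT (test_neg R h delta p q))) <=
  4 * (p * Num.sqrt K%:R * maskmax m * delta%:R `^ (3 / 2)).
Proof.
move=> dh p0 dE /andP[a0 ad] md.
have M0 : 0 <= maskmax m by exact: bigmax_ge_id.
pose b := 2 * (delta%:R * (maskmax m * p)).
have b0 : 0 <= b by rewrite !mulr_ge0.
have -> : delta%:R `^ (3 / 2) = delta%:R * Num.sqrt delta%:R :> R.
  rewrite (_ : 3 / 2 = 1 + 2^-1); last by lra.
  rewrite powRD; last by apply/implyP => _; rewrite pnatr_eq0; lia.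
  by rewrite powRr1// powR12_sqrt.
have -> : 4 * (p * Num.sqrt K%:R * maskmax m * (delta%:R * Num.sqrt delta%:R)) =
    Num.sqrt (K%:R * (4 * delta%:R * b ^+ 2)).
  rewrite (_ : 4 * delta%:R * b ^+ 2 = delta%:R * (2 * b) ^+ 2); last by ring.
  rewrite (sqrtrM _ (ler0n _ _)) (sqrtrM _ (ler0n _ _)) sqrtr_sqr.
  by rewrite ger0_norm ?mulr_ge0// /b; ring.
rewrite -sqrtrM// ler_wsqrtr//.
rewrite mulr_sumr.
apply: (@le_trans _ _ (\sum_(k < K) 4 * delta%:R * b ^+ 2)); last first.
  by rewrite sumr_const card_ord -[_ *+ K]mulr_natl.
apply: ler_sum => k _.
apply: (@le_trans _ _ (a%:R * \sum_(l < L | straddles h delta (l.+1 * a)) b ^+ 2)).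
  rewrite ler_wpM2l// [X in _ <= X]big_mkcond /=; apply: ler_sum => l _.
  rewrite !Zmap_pi !mxE -[X in X ^+ 2 <= _]/(_ - _) -real_normK ?num_real//.
  have lL : (0 < l.+1 * a <= h + h)%N.
    by rewrite dE muln_gt0 a0 mulnC leq_mul2l ltn_ord orbT.
  have := @shifted_mask_diff h delta (l.+1 * a) p q (m k) dh p0 lL (md k).
  case: ifP => _ le; last first.
    by move: le; rewrite normr_le0 => /eqP ->; rewrite normr0 expr0n.
  rewrite ler_sqr ?nnegrE//; apply: le_trans le _.
  rewrite ler_wpM2l// ler_wpM2l// ler_wpM2r//.
  exact: (le_bigmax 0 (fun k => linfnorm (m k)) k).
rewrite sumr_const -[X in _ * X <= _]mulr_natl (mulrA a%:R) -!natrM ler_wpM2r ?sqr_ge0//.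
by rewrite ler_nat mulnC card_straddles.
Qed.

End Masks.

(** * The lower Lipschitz bound *)

Lemma bound_forms_agree (R : realType) (d K L a : nat) (p q M x : R) :
  (0 < L)%N -> d = (a * L)%N ->
  q * Num.sqrt (d * a)%N%:R / (p * Num.sqrt K%:R * M * x) =
  q * d%:R / (p * Num.sqrt (K * L)%N%:R * M * x).
Proof.
move=> L0 ->.
have sL : Num.sqrt L%:R != 0 :> R by rewrite gt_eqF// sqrtr_gt0 ltr0n.
have -> : Num.sqrt (a * L * a)%N%:R = a%:R * Num.sqrt L%:R :> R.
  rewrite (_ : (a * L * a = a ^ 2 * L)%N); last lia.
  by rewrite natrM natrX sqrtrM ?sqr_ge0// sqrtr_sqr ger0_norm.
have -> : (a * L)%N%:R = a%:R * Num.sqrt L%:R * Num.sqrt L%:R :> R.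
  by rewrite natrM -mulrA -expr2 sqr_sqrtr.
rewrite natrM sqrtrM//.
have -> : p * (Num.sqrt K%:R * Num.sqrt L%:R) * M * x =
  (p * Num.sqrt K%:R * M * x) * Num.sqrt L%:R by ring.
by rewrite [in RHS](mulrA q) -[in RHS]mulf_div divff// mulr1.
Qed.

Theorem theorem1 (R : realType) :
  exists C : R, 0 < C /\
    forall (d K L a delta : nat) (m : 'I_K -> 'rV[R[i]]_d) (p q : R)
           (E : set 'M[R]_(K, L)) (B : 'M[R]_(K, L) -> CdPhase R d) (CB : R),
      (0 < d)%N -> ~~ odd d ->
      (0 < K)%N -> (0 < L)%N -> (0 < a)%N -> (0 < delta)%N ->
      delta%:R <= d%:R / 4 :> R -> d = (a * L)%N -> (1 <= a < delta)%N ->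
      (forall (k : 'I_K) (n : 'I_d), m k 0 n != 0 -> (n < delta)%N) ->
      0 < p -> p <= q ->
      [set Zmap L a m x | x in Cpq (d := d) p q] `<=` E ->
      lipschitz_const E B CB ->
      (forall x, Cpq p q x -> B (Zmap L a m x) = x) ->
      CB >= C * ((q * Num.sqrt (d * a)%N%:R) /
                 (p * Num.sqrt K%:R * maskmax m * delta%:R `^ (3 / 2)))
      /\
      C * ((q * Num.sqrt (d * a)%N%:R) /
           (p * Num.sqrt K%:R * maskmax m * delta%:R `^ (3 / 2)))
      = C * ((q * d%:R) /
             (p * Num.sqrt (K * L)%N%:R * maskmax m * delta%:R `^ (3 / 2))).
Proof.
exists (1 / 4); split; first by lra.
move=> d K L a delta m p q E B CB d0 dodd K0 L0 a0 delta0 d4 dE /andP[_ ad] md.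
move=> p0 pq ZE [[CB0 lipB] _] BZ; split; last first.
  by congr (_ * _); apply: bound_forms_agree.
have {}d4 : (4 * delta <= d)%N.
  by rewrite -(ler_nat R) natrM; lra.
have [h dh] : exists h, d = (h + h)%N.
  by exists d./2; rewrite addnn even_halfK.
move: dE; subst d => dE.
have h2 : (2 * delta <= h)%N by lia.
have q0 : 0 < q by lra.
pose X : CdPhase R (h + h) := \pi_(CdPhase R (h + h))%qT (test_pos R h delta p q).
pose Y : CdPhase R (h + h) := \pi_(CdPhase R (h + h))%qT (test_neg R h delta p q).
have CX : Cpq p q X by apply: test_pos_Cpq.
have CY : Cpq p q Y by apply: test_neg_Cpq.
have := lipB _ _ (ZE _ (ex_intro2 _ _ X CX erefl)) (ZE _ (ex_intro2 _ _ Y CY erefl)).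
rewrite (BZ _ CX) (BZ _ CY) => lip.
have lower := D2_test R h delta p q h2 (ltW q0).
have upper := measurement_distance R K L h a delta p q m h2 (ltW p0) dE.
have {}upper := upper _ md.
rewrite a0 (ltnW ad) in upper; have {}upper := upper isT.
set D := _ * _ * _ * _ in upper *.
set Q := q * _.
have Q0 : 0 < Q by rewrite mulr_gt0// sqrtr_gt0 ltr0n muln_gt0 d0.
have QD : Q <= CB * (4 * D).
  apply: le_trans (ler_wpM2l CB0 upper).
  rewrite mulrCA /Q natrM sqrtrM ?ler0n// (mulrA q) (mulrC (q * _)).
  rewrite ler_wpM2l ?sqrtr_ge0//.
  exact: le_trans lower lip.
(* The masks cannot all vanish, since the positive [Q] is bounded by a multiple
   of [D]. *)
have D0 : 0 < D.
  rewrite ltNge; apply/negP => D0; have : CB * (4 * D) <= 0 by nra.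
  lra.
by rewrite mulrA ler_pdivrMr//; lra.
Qed.
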